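(* Let $0<\alpha<\pi$. Every convex disc $C$ in the Euclidean plane has an isosceles cap of angle $\alpha$.
   Context: A convex disc is a compact convex subset of the Euclidean plane with nonempty interior. Let $C$ be a convex disc and $S$ a point outside $C$. Suppose that the two tangent (supporting) lines of $C$ through $S$ touch $C$ at points $P$ and $Q$ respectively, where $P$ (resp. $Q$) may be any point of contact if the line touches $C$ in more than one point. The cap $\widehat{PSQ}$ is the union of the segments $PS$ and $SQ$; its angle is the angle $\angle PSQ$. The cap $\widehat{PSQ}$ is called isosceles if the segments $PS$ and $SQ$ have equal lengths. *)

(* Defs.v *)
From HB Require Import structures.
From mathcomp Require Import all_boot all_order all_algebra.
From mathcomp Require Import all_classical all_reals all_analysis.

Set Implicit Arguments.
Unset Strict Implicit.
Unset Printing Implicit Defensive.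

Import Order.TTheory GRing.Theory Num.Theory.
Import numFieldNormedType.Exports.
Local Open Scope classical_set_scope.
Local Open Scope ring_scope.

Section Plane.
Variable R : realType.
Local Notation plane := 'rV[R]_2.

(* The library norm on 'rV[R]_2 is the sup norm: it induces the Euclidean
   topology (used below for compactness and interiors), but lengths and angles
   have to be computed from the dot product. *)
Definition dot (u v : plane) : R := \sum_i u 0 i * v 0 i.

Definition eucl_norm (u : plane) : R := Num.sqrt (dot u u).

Definition eucl_dist (A B : plane) : R := eucl_norm (B - A).

(* The unoriented angle ASB, with vertex S, in [0, pi]; meaningful when A and B
   are distinct from S. *)
Definition angle (A S B : plane) : R :=
  acos (dot (A - S) (B - S) / (eucl_norm (A - S) * eucl_norm (B - S))).

Definition segment (A B : plane) : set plane :=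
  [set (1 - t) *: A + t *: B | t in `[0, 1]].

Definition convex_disc (C : set plane) : Prop :=
  [/\ compact C, convex_set C & interior C !=set0].

Definition line (n : plane) (c : R) : set plane := [set x | dot n x = c].

(* l is a line meeting C such that C lies in one of the two closed half-planes
   bounded by l; replacing (n, c) by (- n, - c) selects the other one. *)
Definition supporting_line (C l : set plane) : Prop :=
  exists (n : plane) (c : R),
    [/\ n != 0, l = line n c, C `<=` [set x | dot n x <= c]
      & C `&` l !=set0].

(* The cap PSQ of C. The two tangent lines through S are distinct; on each of
   them the point of contact is an arbitrary common point with C. *)
Record cap (C : set plane) : Type := Cap {
  cap_P : plane;
  cap_S : plane;
  cap_Q : plane;
  cap_lineP : set plane;
  cap_lineQ : set plane;
  cap_apex_outside : ~ C cap_S;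
  cap_supportP : supporting_line C cap_lineP;
  cap_supportQ : supporting_line C cap_lineQ;
  cap_lines_distinct : cap_lineP <> cap_lineQ;
  cap_apex_lineP : cap_lineP cap_S;
  cap_apex_lineQ : cap_lineQ cap_S;
  cap_contactP : (C `&` cap_lineP) cap_P;
  cap_contactQ : (C `&` cap_lineQ) cap_Q
}.

Definition cap_set (C : set plane) (K : cap C) : set plane :=
  segment (cap_P K) (cap_S K) `|` segment (cap_S K) (cap_Q K).

Definition cap_angle (C : set plane) (K : cap C) : R :=
  angle (cap_P K) (cap_S K) (cap_Q K).

Definition isosceles (C : set plane) (K : cap C) : Prop :=
  eucl_dist (cap_P K) (cap_S K) = eucl_dist (cap_S K) (cap_Q K).

End Plane.

(* Main.v *)
Require Import Defs.
From mathcomp Require Import all_boot all_order all_algebra.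
From mathcomp Require Import all_classical all_reals all_analysis.
From mathcomp Require Import ring lra.

Set Implicit Arguments.
Unset Strict Implicit.
Unset Printing Implicit Defensive.

Import Order.TTheory GRing.Theory Num.Theory.
Import numFieldNormedType.Exports.
Local Open Scope classical_set_scope.
Local Open Scope ring_scope.

(* Let h be the support function of C, u(x) the unit vector of direction x,
   b = pi - alpha and c = cot (b / 2). The tangent lines with outer normals u(x)
   and u(x + b) meet at angle alpha, and the difference of the two tangent
   lengths is c (h(x + b) - h(x)) - h'(x) - h'(x + b), the derivative of the
   2pi-periodic potential G(x) = c \int_x^(x+b) h - h(x) - h(x + b).
   Take a minimum t of G. Replacing h in the last two terms of G by the smaller
   functions <P, u> and <Q, u>, for contact points P at t and Q at t + b, gives a
   differentiable majorant of G that touches it at t; its derivative vanishes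
   there, so the cap is isosceles.
   It is not degenerate: were the apex S in C, then k = h - <S, u> >= 0 would
   vanish at t and t + b, and minimality would give
   k(x) <= c \int_(t+b)^x k for x >= t + b. By Gronwall k = 0, so that C would
   lie in a line. *)

(** * One-variable calculus *)

(** The integral from [a] is differentiated only to the right of [a]; with [a = 0] this is why all
    later positions are kept positive. *)
Lemma continuous_antiderivative (R : realType) (f : R -> R) (a : R) :
  continuous f ->
  exists F : R -> R, forall x, a < x -> is_derive x 1 F (f x).
Proof.
move=> cf.
exists (fun y => (\int[@lebesgue_measure R]_(t in [set` `[a, y]]) f t)%R) => x ax.
have xu : x < x + 1 by rewrite ltrDl.
have fi : (@lebesgue_measure R).-integrable `[a, x + 1] (EFin \o f).
  apply: continuous_compact_integrable; first exact: segment_compact.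
  exact: continuous_subspaceT.
have [dF <-] := continuous_FTC1_closed xu fi ax (cf x).
by rewrite derive1E; exact/derivableP.
Qed.

Lemma derive_nonneg_le (R : realType) (F f : R -> R) (a b : R) :
  (forall x, a <= x <= b -> is_derive x 1 F (f x)) ->
  (forall x, a <= x <= b -> 0 <= f x) -> a <= b -> F a <= F b.
Proof.
move=> dF f0 ab.
have cF : {within `[a, b], continuous F}.
  apply: derivable_within_continuous => x; rewrite in_itv /= => xab.
  by have := dF _ xab => ?; exact: ex_derive.
have [x xab E] := MVT_segment ab
  (fun x xab => dF x (subset_itv_oo_cc xab)) cF.
by rewrite -subr_ge0 E mulr_ge0 ?subr_ge0 ?f0.
Qed.

(** The product of [F x] with [expR (- (c * x))] is nonincreasing, since its derivative has the sign
    of [f x - c * F x]. *)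
Lemma gronwall_nonpos (R : realType) (F f : R -> R) (c a b : R) :
  (forall x, a <= x <= b -> is_derive x 1 F (f x)) ->
  (forall x, a <= x <= b -> f x <= c * F x) -> a <= b -> F a <= 0 -> F b <= 0.
Proof.
move=> dF fF ab Fa.
have : - (F a * expR (- (c * a))) <= - (F b * expR (- (c * b))).
  apply: (@derive_nonneg_le _ (fun x => - (F x * expR (- (c * x))))
    (fun x => (c * F x - f x) * expR (- (c * x)))) => // x xab.
    have dFx := dF x xab.
    have dcx : is_derive x 1 (fun x => - (c * x)) (- c).
      by apply: is_derive_eq; rewrite /GRing.scale /=; ring.
    have dE := @is_derive1_comp _ expR _ x _ _ _ dcx.
    apply: is_derive_eq; rewrite /GRing.scale /=; ring.
  by rewrite mulr_ge0 ?expR_ge0 // subr_ge0 fF.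
rewrite lerN2 => le; rewrite -(pmulr_lle0 _ (expR_gt0 (- (c * b)))).
by rewrite (le_trans le) // mulr_le0_ge0 // expR_ge0.
Qed.

(** * Unit directions and the support function *)

Section Directions.
Variable R : realType.
Implicit Types (x y b : R) (u v p : 'rV[R]_2).

Definition dir x : 'rV[R]_2 := \row_i (if i == 0 then cos x else sin x).

Lemma dotE u v : dot u v = u 0 0 * v 0 0 + u 0 1 * v 0 1.
Proof.
rewrite /dot !big_ord_recl big_ord0 addr0.
by congr (_ + u _ _ * v _ _); apply: val_inj.
Qed.

Lemma dot_dir p x : dot p (dir x) = p 0 0 * cos x + p 0 1 * sin x.
Proof. by rewrite dotE !mxE. Qed.

Lemma dotC u v : dot u v = dot v u.
Proof. by rewrite !dotE; ring. Qed.

Lemma dotDl u v w : dot (u + v) w = dot u w + dot v w.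
Proof. by rewrite !dotE !mxE; ring. Qed.

Lemma dotBl u v w : dot (u - v) w = dot u w - dot v w.
Proof. by rewrite !dotE !mxE; ring. Qed.

Lemma dotZl a u v : dot (a *: u) v = a * dot u v.
Proof. by rewrite !dotE !mxE; ring. Qed.

Lemma dotNr u v : dot u (- v) = - dot u v.
Proof. by rewrite !dotE !mxE; ring. Qed.

Lemma dot_dir_dir x y : dot (dir x) (dir y) = cos (x - y).
Proof. by rewrite dot_dir !mxE /= cosB. Qed.

Lemma dir_neq0 x : dir x != 0.
Proof.
apply/eqP => /(congr1 (fun v => dot v (dir x))).
rewrite dot_dir_dir subrr cos0 dotE !mxE !mul0r addr0.
by apply/eqP; exact: oner_neq0.
Qed.

Lemma dirDpi x : dir (x + pi) = - dir x.
Proof. by apply/rowP => i; rewrite !mxE cosDpi sinDpi; case: ifP. Qed.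

Lemma dirD2pi x : dir (x + pi *+ 2) = dir x.
Proof. by apply/rowP => i; rewrite !mxE cosD2pi sinD2pi. Qed.

Lemma dir_basis v x :
  v = dot v (dir x) *: dir x + dot v (dir (x + pi / 2)) *: dir (x + pi / 2).
Proof.
have := cos2Dsin2 x => E.
apply/rowP => i; rewrite !mxE !dot_dir cosDpihalf sinDpihalf.
have [->|->] : i = 0 \/ i = 1.
- by case: i => [[|[|]]] // ?; [left|right]; apply: val_inj.
- by rewrite /=; rewrite -[LHS]mulr1 -E; ring.
- by rewrite /=; rewrite -[LHS]mulr1 -E; ring.
Qed.

(* The constant (1 + cos b) / sin b is cot (b / 2). *)
Lemma dot_dir_bisector v x b : sin b != 0 ->
  (1 + cos b) / sin b * (dot v (dir (x + b)) - dot v (dir x)) =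
  dot v (dir (x + pi / 2)) + dot v (dir (x + b + pi / 2)).
Proof.
move=> sb; rewrite !dot_dir !cosDpihalf !sinDpihalf cosD sinD.
have E : cos b ^+ 2 = 1 - sin b ^+ 2 by rewrite -(cos2Dsin2 b) addrK.
apply: (mulfI sb).
rewrite mulrA [sin b * _]mulrC divfK //; ring: E.
Qed.

Lemma is_derive_dot_dir v x :
  is_derive x 1 (fun y => dot v (dir y)) (dot v (dir (x + pi / 2))).
Proof.
rewrite (_ : (fun y => _) = (fun y => v 0 0 * cos y + v 0 1 * sin y)); last first.
  by apply/funext => y; rewrite dot_dir.
by apply: is_derive_eq; rewrite dot_dir cosDpihalf sinDpihalf /GRing.scale /=; ring.
Qed.

Lemma continuous_dotl w : continuous (fun v => dot v w).
Proof.
rewrite (_ : (fun v => _) = (fun v => v 0 0 * w 0 0 + v 0 1 * w 0 1)); last first.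
  by apply/funext => v; rewrite dotE.
move=> v; apply: (@cvgD _ _ _ (nbhs v)); apply: (@cvgM _ _ (nbhs v));
  by [exact: coord_continuous|exact: cvg_cst].
Qed.

(** A short move from an interior point along [n] stays in [C] but changes the dot product with
    [n]. *)
Lemma interior_not_in_line (C : set 'rV[R]_2) (n : 'rV[R]_2) (d : R) :
  n != 0 -> C° !=set0 -> ~ C `<=` line n d.
Proof.
move=> n0 [p pC] Cl.
have np : 0 < dot n n.
  rewrite lt0r; apply/andP; split; last by rewrite dotE addr_ge0 // -expr2 sqr_ge0.
  apply: contra n0; rewrite dotE paddr_eq0 -?expr2 ?sqr_ge0 // !sqrf_eq0.
  move=> /andP[/eqP n0 /eqP n1]; apply/eqP/rowP => i; rewrite mxE.
  by case: i => [[|[|]]] // ?; [rewrite -n0|rewrite -n1]; congr (n _ _); apply: val_inj.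
have cont : (fun r : R => p + r *: n) @ (0 : R) --> p.
  rewrite -{2}[p]addr0 -(scale0r n); apply: cvgD; first exact: cvg_cst.
  by apply: cvgZ; [exact: cvg_id|exact: cvg_cst].
have [e /= e0 eC] := cont _ pC.
have /eC /Cl : ball (0 : R) e (e / 2).
  by rewrite /ball /= sub0r normrN gtr0_norm ?divr_gt0 //; lra.
have : C p := interior_subset pC.
move=> /Cl; rewrite /line /= ![dot n _]dotC dotDl dotZl => -> /eqP.
rewrite -subr_eq0 addrC addKr mulf_eq0 !gt_eqF //; exact: divr_gt0.
Qed.

Lemma exists_support_points (C : set 'rV[R]_2) : compact C -> C !=set0 ->
  exists p : R -> 'rV[R]_2, forall x,
    C (p x) /\ forall q, C q -> dot q (dir x) <= dot (p x) (dir x).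
Proof.
move=> cC C0.
suff /choice[p Hp] : forall x, exists p,
  C p /\ forall q, C q -> dot q (dir x) <= dot p (dir x) by exists p.
move=> x; have [p pC max] := @compact_EVT_max _ _ (fun v => dot v (dir x)) _ C0 cC
  (continuous_subspaceT (@continuous_dotl (dir x))).
by exists p; split => [|q Cq]; [exact/set_mem|apply: max; exact/mem_set].
Qed.

(** The contact point [p x] may jump, but its product with [dir x] does not: for all [q] in the
    bounded set [C] the functions [dot q (dir x)] share one modulus of continuity, which passes to
    their maximum. *)
Lemma continuous_support (C : set 'rV[R]_2) (p : R -> 'rV[R]_2) : compact C ->
  (forall x, C (p x) /\ forall q, C q -> dot q (dir x) <= dot (p x) (dir x)) ->
  continuous (fun x => dot (p x) (dir x)).
Proof.
move=> /compact_bounded/ex_strict_bound_gt0[M M0 CM] Hp x.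
have entry q i : C q -> `|q 0 i| <= M.
  move=> /CM qM; apply/ltW/(le_lt_trans _ qM).
  by rewrite [`|q|]mx_normrE (le_trans _ (le_bigmax _ _ (0, i))).
have diff q y z : C q -> dot q (dir y) - dot q (dir z) <=
    M * (`|cos y - cos z| + `|sin y - sin z|).
  move=> Cq; rewrite (le_trans (ler_norm _)) // !dot_dir.
  rewrite (_ : _ - _ = q 0 0 * (cos y - cos z) + q 0 1 * (sin y - sin z)); last by ring.
  rewrite (le_trans (ler_normD _ _)) // !normrM mulrDr.
  by rewrite lerD // ler_wpM2r // entry.
have lip y : `|dot (p x) (dir x) - dot (p y) (dir y)| <=
    M * (`|cos x - cos y| + `|sin x - sin y|).
  have [Cx Hx] := Hp x; have [Cy Hy] := Hp y.
  rewrite ler_norml; apply/andP; split.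
    rewrite lerNl opprB distrC (distrC (sin x)) (le_trans _ (diff _ _ _ Cy)) //.
    by rewrite lerB // Hx.
  by rewrite (le_trans _ (diff _ _ _ Cx)) // lerB // Hy.
apply/cvgrPdist_le => e e0.
have e1 : 0 < e / (2 * M) by rewrite divr_gt0 // mulr_gt0.
have /cvgrPdist_le/(_ _ e1) c1 := @continuous_cos R x.
have /cvgrPdist_le/(_ _ e1) s1 := @continuous_sin R x.
near=> y; apply: (le_trans (lip y)).
have -> : e = M * (e / (2 * M) + e / (2 * M)) by field; exact: lt0r_neq0.
rewrite ler_wpM2l ?(ltW M0) // lerD //; near: y; assumption.
Unshelve. all: by end_near. Qed.

End Directions.

(** * The potential and its minimum *)

Lemma is_derive_comp_shift (R : realType) (f : R -> R) (x b df : R) :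
  is_derive (x + b) 1 f df -> is_derive x 1 (fun y => f (y + b)) df.
Proof.
move=> dxb.
have := @is_derive1_comp _ f (fun y => y + b) x _ _ dxb (is_derive_shift x 1 b).
by rewrite mulr1.
Qed.

(** This is [G] above, with the integral expressed through an antiderivative [H] of [h]. *)
Definition potential (R : realType) (h H : R -> R) (c b x : R) : R :=
  c * (H (x + b) - H x) - h x - h (x + b).

(** [H] need not be periodic, but [H (z + pi *+ 2) - H z] has derivative zero and so agrees at [x]
    and [x + b]. *)
Lemma potential_periodic (R : realType) (h H : R -> R) (c b x : R) :
  (forall y : R, 0 < y -> is_derive y 1 H (h y)) -> periodic h (pi *+ 2) ->
  0 < b -> 0 < x -> potential h H c b (x + pi *+ 2) = potential h H c b x.
Proof.
move=> dH per b0 x0; have pi0 := pi_gt0 R.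
have dE (y : R) : x <= y <= x + b -> is_derive y 1 (fun z => H (z + pi *+ 2) - H z) 0.
  move=> /andP[xy _].
  have y0 : 0 < y by apply: lt_le_trans xy.
  have d1 := dH _ y0.
  have d2 : is_derive y 1 (fun z => H (z + pi *+ 2)) (h (y + pi *+ 2)).
    by apply/is_derive_comp_shift/dH; rewrite addr_gt0 // mulrn_wgt0.
  by apply: is_derive_eq; rewrite per subrr.
have xb : x <= x + b by rewrite lerDl ltW.
have le := derive_nonneg_le dE (fun _ _ => lexx 0) xb.
have dNE (y : R) : x <= y <= x + b ->
    is_derive y 1 (fun z => - (H (z + pi *+ 2) - H z)) 0.
  by move=> /dE d; apply: is_derive_eq; rewrite oppr0.
have ge := derive_nonneg_le dNE (fun _ _ => lexx 0) xb.
rewrite /potential per (addrAC x _ b) per; congr (_ * _ - _ - _); lra.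
Qed.

(** The minimum is taken over the middle one of three periods, and a point of either outer period is
    shifted into it. Thus [t] is interior to the range of comparison, with a full period of room on
    each side. *)
Lemma potential_min (R : realType) (h H : R -> R) (c b : R) :
  continuous h -> (forall y : R, 0 < y -> is_derive y 1 H (h y)) ->
  periodic h (pi *+ 2) -> 0 < b ->
  exists2 t, pi *+ 2 <= t <= pi *+ 4 & forall x, 0 < x < pi *+ 6 ->
    potential h H c b t <= potential h H c b x.
Proof.
move=> ch dH per b0; have pi0 := pi_gt0 R.
have p24 : (pi : R) *+ 2 <= pi *+ 4 by rewrite ler_wpMn2l // ltW.
have [|t] := @EVT_min _ (potential h H c b) _ _ p24.
  have cH y : 0 < y -> {for y, continuous H}.
    move=> /dH d; apply: differentiable_continuous.
    by apply/derivable1_diffP; exact: ex_derive.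
  apply: continuous_in_subspaceT => x; rewrite inE /= in_itv /= => /andP[x2 _].
  have x0 : 0 < x by apply: lt_le_trans x2; rewrite mulrn_wgt0.
  have cs : {for x, continuous (fun y : R => y + b)}.
    by apply: cvgD; [exact: cvg_id|exact: cvg_cst].
  apply: cvgB; [apply: cvgB|].
  - apply: cvgM; [exact: cvg_cst|apply: cvgB; last exact: cH].
    by apply: (@continuous_comp _ _ _ (fun y => y + b) H) => //; apply/cH/addr_gt0.
  - exact: ch.
  - by apply: (@continuous_comp _ _ _ (fun y => y + b) h) => //; exact: ch.
rewrite in_itv /= => t24 tmin; exists t => // x /andP[x0 x6].
have [x2|x2] := ltP x (pi *+ 2).
  rewrite -(potential_periodic c dH per b0 x0); apply: tmin.
  by rewrite in_itv /=; move: x0 x2 pi0; rewrite !mulr2n !mulrS mulr0n; lra.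
have [x4|x4] := leP x (pi *+ 4).
  by apply: tmin; rewrite in_itv /= x2.
have y0 : 0 < x - pi *+ 2 by rewrite subr_gt0 (le_lt_trans _ x4).
rewrite -(subrK (pi *+ 2) x) (potential_periodic c dH per b0 y0); apply: tmin.
by rewrite in_itv /=; move: x4 x6; rewrite !mulrS mulr0n; lra.
Qed.

Lemma potential_min_stationary (R : realType) (h H : R -> R) (c b t r : R)
    (P Q : 'rV[R]_2) :
  (forall y : R, 0 < y -> is_derive y 1 H (h y)) -> 0 < b -> 0 < t < r ->
  (forall x, 0 < x < r -> potential h H c b t <= potential h H c b x) ->
  (forall x, dot P (dir x) <= h x) -> dot P (dir t) = h t ->
  (forall x, dot Q (dir x) <= h x) -> dot Q (dir (t + b)) = h (t + b) ->
  c * (h (t + b) - h t) =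
  dot P (dir (t + pi / 2)) + dot Q (dir (t + b + pi / 2)).
Proof.
move=> dH b0 tr tmin Ph Pt Qh Qt.
(* The majorant of the potential: it is differentiable even where [h] has corners. *)
pose g x := c * (H (x + b) - H x) - dot P (dir x) - dot Q (dir (x + b)).
have dg (x : R) : 0 < x -> is_derive x 1 g (c * (h (x + b) - h x)
    - dot P (dir (x + pi / 2)) - dot Q (dir (x + b + pi / 2))).
  move=> x0; have d1 := dH _ x0.
  have d2 : is_derive x 1 (fun z => H (z + b)) (h (x + b)).
    by apply/is_derive_comp_shift/dH; rewrite addr_gt0.
  have d3 := is_derive_dot_dir P x.
  have d4 := is_derive_comp_shift (is_derive_dot_dir Q (x + b)).
  by apply: is_derive_eq.
have [t0 _] := andP tr.
have dt : is_derive t 1 g 0.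
  apply: (@derive1_at_min _ _ 0 r) => [||//|x].
  - by case/andP: tr => ? ?; apply/ltW/(lt_trans t0).
  - by move=> x; rewrite in_itv /= => /andP[x0 _]; have := dg x x0 => d; exact: ex_derive.
  rewrite in_itv /= => /tmin le.
  have -> : g t = potential h H c b t by rewrite /g /potential Pt Qt.
  by apply: (le_trans le); rewrite /potential /g -!addrA lerD2l lerD // lerN2.
have := dg t t0 => d; move: (@derive_val _ _ _ _ _ _ _ dt).
rewrite (@derive_val _ _ _ _ _ _ _ d); lra.
Qed.

(* The potential does not change when h is replaced by k = h - <S, u>. *)
Lemma potential_min_corner (R : realType) (h H : R -> R) (b t r : R)
    (S : 'rV[R]_2) :
  let c := (1 + cos b) / sin b in
  (forall y : R, 0 < y -> is_derive y 1 H (h y)) -> 0 < b < pi -> 0 < t ->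
  (forall x, 0 < x < r -> potential h H c b t <= potential h H c b x) ->
  (forall x, dot S (dir x) <= h x) ->
  dot S (dir t) = h t -> dot S (dir (t + b)) = h (t + b) ->
  forall x, t <= x < r -> h (x + b) = dot S (dir (x + b)).
Proof.
move=> c dH /andP[b0 bpi] t0 tmin Sh St Stb x0 /andP[tx0 x0r].
have sb : 0 < sin b by rewrite sin_gt0_pi ?b0.
have c0 : 0 <= c by rewrite divr_ge0 ?(ltW sb) // -lerBlDl sub0r cos_geN1.
pose k x := h x - dot S (dir x).
(* A quarter turn back integrates [dot S (dir x)], so [K] is an antiderivative of [k]. *)
pose K x := H x - dot S (dir (x - pi / 2)).
have k0 x : 0 <= k x by rewrite subr_ge0.
have dK (x : R) : 0 < x -> is_derive x 1 K (k x).
  move=> xp; have d1 := dH _ xp.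
  have d2 := is_derive_comp_shift (is_derive_dot_dir S (x - pi / 2)).
  by apply: is_derive_eq; rewrite /k subrK.
(* The part of the potential that comes from [S] vanishes identically, by the bisector identity at
   [x - pi / 2]. *)
have potE x : potential h H c b x = potential k K c b x.
  have := dot_dir_bisector S (x - pi / 2) (lt0r_neq0 sb).
  by rewrite /potential /k /K addrAC !subrK -/c; lra.
have kt : k t = 0 by rewrite /k St subrr.
have ktb : k (t + b) = 0 by rewrite /k Stb subrr.
(* Minimality also leaves [- k x] and [- c * (K x - K t)] on the right; both are nonpositive and are
   dropped. *)
have kK x : t <= x < r -> k (x + b) <= c * (K (x + b) - K (t + b)).
  move=> /andP[tx xr]; have x0' : 0 < x by apply: lt_le_trans tx.
  have := tmin x; rewrite x0' xr => /(_ isT).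
  rewrite !potE /potential kt ktb.
  have Kle : K t <= K x.
    by apply: derive_nonneg_le tx => [y /andP[ty _]|//]; apply/dK/(lt_le_trans t0).
  have := k0 x; have := ler_wpM2l c0 Kle; lra.
have Fle : K (x0 + b) - K (t + b) <= 0.
  apply: (@gronwall_nonpos _ (fun x => K (x + b) - K (t + b))
    (fun x => k (x + b)) c t) => // [x /andP[tx _]|x /andP[tx xx]|].
  - have d : is_derive x 1 (fun z => K (z + b)) (k (x + b)).
      by apply/is_derive_comp_shift/dK; rewrite addr_gt0 // (lt_le_trans t0).
    by apply: is_derive_eq; rewrite subr0.
  - by apply: kK; rewrite tx (le_lt_trans xx).
  - by rewrite subrr.
apply/eqP; rewrite -subr_eq0 eq_le k0 andbT.
apply: (le_trans (kK x0 _)); first by rewrite tx0.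
by rewrite mulr_ge0_le0.
Qed.

(** * The apex, its angle and the tangent lengths *)

Lemma dot_dir_tangent (R : realType) (x b : R) :
  dot (dir (x + pi / 2)) (dir (x + b)) = sin b.
Proof.
rewrite dot_dir_dir (_ : _ - _ = pi / 2 - b); last by ring.
by rewrite cosB cos_pihalf sin_pihalf; ring.
Qed.

Lemma dot_dir_normal (R : realType) (x : R) : dot (dir (x + pi / 2)) (dir x) = 0.
Proof. by rewrite dot_dir_dir addrAC subrr add0r cos_pihalf. Qed.

Lemma exists_apex (R : realType) (x b d e : R) : sin b != 0 ->
  exists S : 'rV[R]_2, dot S (dir x) = d /\ dot S (dir (x + b)) = e.
Proof.
move=> sb.
(* The coefficient [y] of [dir (x + pi / 2)] solves [d * cos b + y * sin b = e]. *)
exists (d *: dir x + ((e - d * cos b) / sin b) *: dir (x + pi / 2)).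
rewrite !dotDl !dotZl dot_dir_normal dot_dir_tangent !dot_dir_dir subrr cos0.
by rewrite opprD addNKr cosN divfK //; split; ring.
Qed.

Lemma eucl_norm_dir (R : realType) (s x : R) :
  0 <= s -> eucl_norm (s *: dir x) = s.
Proof.
move=> s0; rewrite /eucl_norm dotZl dotC dotZl dot_dir_dir subrr cos0 mulr1.
by rewrite -expr2 sqrtr_sqr ger0_norm.
Qed.

Lemma eucl_normN (R : realType) (v : 'rV[R]_2) : eucl_norm (- v) = eucl_norm v.
Proof. by congr Num.sqrt; rewrite !dotE !mxE; ring. Qed.

(** The path from [P] through [S] to [Q] turns by [b] at [S], which leaves the interior angle
    [pi - b]. *)
Lemma angle_dir (R : realType) (P S Q : 'rV[R]_2) (s x b : R) :
  0 < s -> 0 <= b <= pi -> S - P = s *: dir x -> Q - S = s *: dir (x + b) ->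
  angle P S Q = pi - b.
Proof.
move=> s0 /andP[b0 bpi] SP QS.
rewrite /angle -[P - S]opprB SP QS eucl_normN !eucl_norm_dir ?(ltW s0) //.
rewrite -scaleNr dotZl [dot (dir _) _]dotC dotZl dot_dir_dir addrAC subrr add0r.
have -> : - s * (s * cos b) / (s * s) = cos (pi - b).
  by rewrite cosB cospi sinpi; field; exact: lt0r_neq0.
by rewrite cosK // in_itv /=; apply/andP; split; lra.
Qed.

Lemma supporting_line_dir (R : realType) (C : set 'rV[R]_2) (p : 'rV[R]_2) (x : R) :
  C p -> (forall q, C q -> dot q (dir x) <= dot p (dir x)) ->
  supporting_line C (line (dir x) (dot p (dir x))).
Proof.
move=> Cp pmax; exists (dir x), (dot p (dir x)); split=> //.
- exact: dir_neq0.
- by move=> q /pmax; rewrite /= dotC.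
- by exists p; split; rewrite // /line /= dotC.
Qed.

Theorem theorem4 (R : realType) (alpha : R) (halpha : 0 < alpha < pi)
    (C : set 'rV[R]_2) (hC : convex_disc C) :
  exists K : cap C, isosceles K /\ cap_angle K = alpha.
Proof.
have [cC _ iC] := hC; have pi0 := pi_gt0 R.
pose b := pi - alpha.
have b0pi : 0 < b < pi by rewrite /b; lra.
have [b0 bpi] := andP b0pi.
have sb : 0 < sin b by rewrite sin_gt0_pi.
have sbn0 := lt0r_neq0 sb.
have C0 : C !=set0 by have [q /interior_subset Cq] := iC; exists q.
have [p Hp] := exists_support_points cC C0.
pose h x := dot (p x) (dir x).
have Cp x : C (p x) by case: (Hp x).
have ph x q : C q -> dot q (dir x) <= h x by case: (Hp x) => _; exact.
have ch : continuous h := continuous_support cC Hp.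
have per : periodic h (pi *+ 2).
  by move=> x; apply/eqP; rewrite /h dirD2pi eq_le {1}ph //= -(dirD2pi x) ph.
have [H dH] := continuous_antiderivative 0 ch.
pose c := (1 + cos b) / sin b.
have [t /andP[t2 t4] tmin] := potential_min c ch dH per b0.
have t0 : 0 < t by apply: lt_le_trans t2; rewrite mulrn_wgt0.
(* Room to apply the corner argument at [t + pi]. *)
have t6 : t + pi < pi *+ 6 by move: t4; rewrite !mulrS mulr0n; lra.
have tr : 0 < t < pi *+ 6 by rewrite t0 /=; lra.
set P := p t; set Q := p (t + b).
have [S [St Stb]] := exists_apex t (h t) (h (t + b)) sbn0.
(* If [S] were in [C], it would be extremal in the direction [t + b] and also in the opposite one,
   so [C] would have width zero there. *)
have CS : ~ C S.
  move=> CS.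
  have corner := potential_min_corner dH b0pi t0 tmin
    (fun x => ph x S CS) St Stb.
  have h1 : h (t + pi + b) = dot S (dir (t + pi + b)) by apply: corner; lra.
  apply: (@interior_not_in_line _ C (dir (t + b)) (dot S (dir (t + b)))) => //.
    exact: dir_neq0.
  move=> q Cq; rewrite /line /= dotC; apply/eqP; rewrite eq_le Stb ph //=.
  have := ph (t + pi + b) q Cq.
  by rewrite h1 addrAC dirDpi !dotNr lerN2 Stb.
have := potential_min_stationary dH b0 tr tmin
  (fun x => ph x P (Cp t)) erefl (fun x => ph x Q (Cp (t + b))) erefl.
(* As [S] lies on both tangent lines, the bisector identity turns stationarity into equality of the
   signed tangent lengths from [P] to [S] and from [S] to [Q]. *)
rewrite -St -Stb dot_dir_bisector // => stat.
pose s := dot (S - P) (dir (t + pi / 2)).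
have SP : S - P = s *: dir (t + pi / 2).
  by rewrite [LHS](dir_basis _ t) dotBl St subrr scale0r add0r.
have QS : Q - S = s *: dir (t + b + pi / 2).
  rewrite [LHS](dir_basis _ (t + b)) dotBl Stb subrr scale0r add0r.
  by congr (_ *: _); rewrite /s !dotBl; lra.
(* [s = 0] would give [S = P] in [C]. For the sign, [s * sin b] is the product of [S - P] with
   [dir (t + b)], which is nonnegative because [P] lies in the half-plane bounded by the second
   tangent line. *)
have s0 : 0 < s.
  rewrite lt0r; apply/andP; split.
    apply/eqP => s0; apply: CS; move: SP; rewrite s0 scale0r => /subr0_eq ->.
    exact: Cp.
  rewrite -(pmulr_lge0 _ sb) -(dot_dir_tangent t) -dotZl -SP dotBl Stb subr_ge0.
  exact/ph/Cp.
have SlP : line (dir t) (h t) S by rewrite /line /= dotC.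
have SlQ : line (dir (t + b)) (h (t + b)) S by rewrite /line /= dotC.
(* Moving [S] along the first line by a unit vector changes the product with the normal of the
   second line by [sin b], which is nonzero. *)
have PQ : line (dir t) (h t) <> line (dir (t + b)) (h (t + b)).
  move=> E; have : line (dir t) (h t) (S + dir (t + pi / 2)).
    by rewrite /line /= dotC dotDl St dot_dir_normal addr0.
  rewrite E /line /= dotC dotDl Stb dot_dir_tangent => /eqP.
  by rewrite -subr_eq0 addrC addKr (negPf sbn0).
have lP : supporting_line C (line (dir t) (h t)).
  exact: supporting_line_dir (ph t).
have lQ : supporting_line C (line (dir (t + b)) (h (t + b))).
  exact: supporting_line_dir (ph (t + b)).
have PlP : (C `&` line (dir t) (h t)) P.
  by split; [exact: Cp|rewrite /line /= dotC].
have QlQ : (C `&` line (dir (t + b)) (h (t + b))) Q.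
  by split; [exact: Cp|rewrite /line /= dotC].
exists (Cap CS lP lQ PQ SlP SlQ PlP QlQ); split.
  by rewrite /isosceles /eucl_dist /= SP QS !eucl_norm_dir ?ltW.
rewrite /cap_angle /= (@angle_dir _ _ _ _ s (t + pi / 2) b) //.
- by rewrite /b; ring.
- by rewrite !ltW.
- by rewrite addrAC.
Qed.
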